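(* Let $(x^k)_{k\in\mathbb{N}}$ be an infinite sequence generated by GInexPM with Armijo search (as described in the context). Assume that $f^*>-\infty$, that $\nabla f$ is Lipschitz continuous on $C$ with constant $L>0$, and that $(x^k)_{k\in\mathbb{N}}$ converges to a point $x^*$. Let $$\tau_{\min}:=\min\left\{\frac{2\tau(1-\sigma)(1-\bar\gamma)}{\alpha_{\max}L},\,1\right\}.$$ Then, for every integer $N\ge 1$, $$\min\{\|w^k-x^k\|:\ k=0,1,\dots,N-1\}\le\sqrt{\frac{\alpha_{\max}\,[f(x^0)-f^*]}{\sigma\,\tau_{\min}(1-\bar\gamma)}}\ \frac1{\sqrt N}.$$
   Context: Setting. $C\subset\mathbb{R}^n$ is a nonempty closed convex set, $f:\mathbb{R}^n\to\mathbb{R}$ is continuously differentiable, $f^*:=\inf_{x\in C}f(x)$; $\langle\cdot,\cdot\rangle$ and $\|\cdot\|$ are the Euclidean inner product and norm; $\mathbb{N}=\{0,1,2,\dots\}$. Lipschitz gradient on $C$: $\|\nabla f(x)-\nabla f(y)\|\le L\|x-y\|$ for all $x,y\in C$. Inexact projection. For each $\gamma_3\ge 0$, $\varphi_{\gamma_3}:\mathbb{R}^n\times\mathbb{R}^n\to[0,\infty)$ is a function with $\varphi_{\gamma_3}(u,w)\le\gamma_3\|w-u\|^2$ for all $u,w$, and the map $(\gamma_3,u,w)\mapsto\varphi_{\gamma_3}(u,w)$ is continuous. For $u\in C$, $v\in\mathbb{R}^n$, $\mathcal{P}_C(\varphi_{\gamma_3},u,v):=\{w\in C:\langle v-w,y-w\rangle\le\varphi_{\gamma_3}(u,w)\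 \forall y\in C\}$. GInexPM with Armijo search. Fix $\sigma,\tau\in(0,1)$, $0<\alpha_{\min}\le\alpha_{\max}$, $\bar\gamma<1/2$, and $x^0\in C$. At iteration $k$: choose reals $\alpha_k,\gamma_3^k$ with $\alpha_{\min}\le\alpha_k\le\alpha_{\max}$ and $0\le\gamma_3^k\le\bar\gamma$, set $z^k:=x^k-\alpha_k\nabla f(x^k)$ and take any $w^k\in\mathcal{P}_C(\varphi_{\gamma_3^k},x^k,z^k)$. If $w^k=x^k$, stop. Otherwise set $\tau_k:=\tau^{j_k}$ with $j_k:=\min\{j\in\mathbb{N}: f(x^k+\tau^j(w^k-x^k))\le f(x^k)+\sigma\tau^j\langle\nabla f(x^k),w^k-x^k\rangle\}$ and $x^{k+1}:=x^k+\tau_k(w^k-x^k)$. ''Infinite sequence generated'' means the algorithm never stops (a standing assumption of the paper). *)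

(* Defs.v *)
From HB Require Import structures.
From mathcomp Require Import all_boot all_order all_algebra.
From mathcomp Require Import all_classical all_reals all_analysis.

Set Implicit Arguments.
Unset Strict Implicit.
Unset Printing Implicit Defensive.

Import Order.TTheory GRing.Theory Num.Theory.
Import numFieldNormedType.Exports.

Local Open Scope classical_set_scope.
Local Open Scope ring_scope.

Section GInexPM.
Context {R : realType} {n : nat}.
Implicit Types (f : 'rV[R]_n -> R) (C : set 'rV[R]_n) (u v w : 'rV[R]_n).
Implicit Types (phi : R -> 'rV[R]_n -> 'rV[R]_n -> R).

Definition dotp u v : R := \sum_(i < n) u 0 i * v 0 i.

(* The library norm [`|u|] on ['rV[R]_n] is the sup norm; it induces the same
   topology, so closedness, continuity, differentiability and limits below are
   the library's, while every norm in a formula is this one. *)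
Definition enorm u : R := Num.sqrt (dotp u u).

Definition grad f v : 'rV[R]_n := \row_(i < n) 'D_(delta_mx 0 i) f v.

Definition C1 f := (forall v, differentiable f v) /\ continuous (grad f).

Definition lipschitz_grad_on f C (L : R) :=
  forall u v, C u -> C v -> enorm (grad f u - grad f v) <= L * enorm (u - v).

Definition inf_on f C : \bar R := ereal_inf [set (f v)%:E | v in C].

(* Only the values of [phi] at nonnegative parameters are meaningful, so both
   the bounds and the joint continuity are required there only. *)
Definition inexactness phi :=
  (forall (g : R) u w, 0 <= g -> 0 <= phi g u w <= g * enorm (w - u) ^+ 2) /\
  {within [set p : R * 'rV[R]_n * 'rV[R]_n | 0 <= p.1.1],
    continuous (fun p => phi p.1.1 p.1.2 p.2)}.

Definition inexact_proj C (phi_g : 'rV[R]_n -> 'rV[R]_n -> R) u v :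
    set 'rV[R]_n :=
  [set w | C w /\ forall y, C y -> dotp (v - w) (y - w) <= phi_g u w].

Definition armijo f (sigma tau : R) (x w : 'rV[R]_n) (j : nat) :=
  f (x + tau ^+ j *: (w - x)) <=
  f x + sigma * tau ^+ j * dotp (grad f x) (w - x).

(* A run that never stops; [j k] is the exponent of the k-th step size. *)
Record GInexPM_armijo f C phi (sigma tau amin amax gbar : R)
    (alpha gamma : nat -> R) (j : nat -> nat) (x w : nat -> 'rV[R]_n) : Prop :=
{ GInexPM_start : C (x 0%N);
  GInexPM_alpha : forall k, amin <= alpha k <= amax;
  GInexPM_gamma : forall k, 0 <= gamma k <= gbar;
  GInexPM_proj : forall k,
    inexact_proj C (phi (gamma k)) (x k) (x k - alpha k *: grad f (x k)) (w k);
  GInexPM_nonstop : forall k, w k <> x k;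
  GInexPM_search : forall k, armijo f sigma tau (x k) (w k) (j k);
  GInexPM_search_min : forall k i,
    armijo f sigma tau (x k) (w k) i -> (j k <= i)%N;
  GInexPM_next : forall k, x k.+1 = x k + tau ^+ j k *: (w k - x k) }.

End GInexPM.

(* Main.v *)
Require Import Defs.
From HB Require Import structures.
From mathcomp Require Import all_boot all_order all_algebra.
From mathcomp Require Import ring lra.
From mathcomp Require Import all_classical all_reals all_analysis.

Set Implicit Arguments.
Unset Strict Implicit.
Unset Printing Implicit Defensive.

Import Order.TTheory GRing.Theory Num.Theory.
Import numFieldNormedType.Exports.

Local Open Scope classical_set_scope.
Local Open Scope ring_scope.

(** Every iteration decreases [f] by at least a fixed multiple of
    [||w^k - x^k||^2], and the total decrease available is [f(x^0) - f^*]; so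
    the squared steps are summable with a known bound, and the least of the
    first [N] of them is at most that bound divided by [N].

    Write [d = w^k - x^k].  Three facts give the uniform decrease.

    - Testing the inexact projection against the point [x^k] of [C] shows that
      [d] is a direction of descent with slope
      [<grad f(x^k), d> <= - c ||d||^2], where [c = (1 - gbar) / amax]
      ([inexact_proj_slope]).

    - The step size cannot be small ([armijo_step_ge]): if [tau^(j-1)] was
      rejected by the line search, then the quadratic upper model of [f] along
      [d] ([descent_lemma]), which bounds [f] from above on [C], forces
      [(1 - sigma) c < (L / 2) tau^(j-1)].  Hence [tau^j >= tau_min].

    - The accepted step satisfies the Armijo inequality, so
      [f(x^k) - f(x^(k+1)) >= sigma tau_min c ||d||^2].

    Convexity of [C] keeps the iterates, and the segments on which the
    gradient is compared, inside [C].  Telescoping the last inequality and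
    passing to the minimum ([min_le_of_sum_sqr_le]) gives the rate. *)

(** * Euclidean inner product and norm *)

Section Dotp.
Context {R : realType} {n : nat}.
Implicit Types u v w : 'rV[R]_n.

Lemma dotpC u v : dotp u v = dotp v u.
Proof. by apply: eq_bigr => i _; rewrite mulrC. Qed.

Lemma dotpDl u v w : dotp (u + v) w = dotp u w + dotp v w.
Proof. by rewrite -big_split; apply: eq_bigr => i _; rewrite !mxE mulrDl. Qed.

Lemma dotpZl a u v : dotp (a *: u) v = a * dotp u v.
Proof.
by rewrite [RHS]big_distrr; apply: eq_bigr => i _; rewrite !mxE -mulrA.
Qed.

Lemma dotpNl u v : dotp (- u) v = - dotp u v.
Proof. by rewrite -scaleN1r dotpZl mulN1r. Qed.

Lemma dotpBl u v w : dotp (u - v) w = dotp u w - dotp v w.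
Proof. by rewrite dotpDl dotpNl. Qed.

Lemma dotpZr a u v : dotp u (a *: v) = a * dotp u v.
Proof. by rewrite dotpC dotpZl dotpC. Qed.

Lemma dotpNr u v : dotp u (- v) = - dotp u v.
Proof. by rewrite dotpC dotpNl dotpC. Qed.

Lemma dotpBr u v w : dotp u (v - w) = dotp u v - dotp u w.
Proof. by rewrite dotpC dotpBl !(dotpC u). Qed.

Lemma dotp_ge0 u : 0 <= dotp u u.
Proof. by apply: sumr_ge0 => i _; rewrite -expr2 sqr_ge0. Qed.

Lemma enorm_ge0 u : 0 <= enorm u.
Proof. exact: sqrtr_ge0. Qed.

Lemma sqr_enorm u : enorm u ^+ 2 = dotp u u.
Proof. by rewrite sqr_sqrtr // dotp_ge0. Qed.

Lemma enormZ a u : 0 <= a -> enorm (a *: u) = a * enorm u.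
Proof.
move=> a0; rewrite /enorm dotpZl dotpZr mulrA -expr2.
by rewrite sqrtrM ?sqr_ge0 // sqrtr_sqr ger0_norm.
Qed.

(** This is the only consequence of Cauchy-Schwarz used below.  It follows
    directly from [0 <= ||u - c v||^2], since the hypothesis bounds
    [||u||^2 + c^2 ||v||^2] by [2 c^2 ||v||^2]. *)
Lemma dotp_le_of_enorm_le (c : R) u v : 0 < c ->
  enorm u <= c * enorm v -> dotp u v <= c * enorm v ^+ 2.
Proof.
move=> c0 huv.
have := dotp_ge0 (u - c *: v).
rewrite dotpBl !dotpBr !dotpZl !dotpZr (dotpC v u) -!sqr_enorm => h.
have h2 : enorm u ^+ 2 <= (c * enorm v) ^+ 2.
  by rewrite lerXn2r ?nnegrE ?mulr_ge0 ?enorm_ge0 // ltW.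
rewrite exprMn in h2.
rewrite -(ler_pM2l (_ : 0 < 2 * c)) ?mulr_gt0 //.
lra.
Qed.

(** Puts the library's convex combination, weighted from its first argument,
    in the form in which a step of the algorithm is written. *)
Lemma convex_segment (C : set 'rV[R]_n) u v t :
  convex_set (C : set (convex_lmodType 'rV[R]_n)) ->
  C u -> C v -> 0 <= t <= 1 -> C (u + t *: (v - u)).
Proof.
move=> hC Cu Cv t01.
have := hC v u (Itv01 (proj1 (andP t01)) (proj2 (andP t01))).
rewrite !inE => /(_ Cv Cu).
rewrite /conv /=.
suff -> : (t *: v + (1 - t) *: u : 'rV[R]_n) = u + t *: (v - u) by [].
by rewrite scalerBl scale1r scalerBr addrC -addrA (addrC (- _)).
Qed.
End Dotp.

(** * The quadratic upper model along a segment *)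

Section Descent.
Context {R : realType} {n : nat}.
Implicit Types (f : 'rV[R]_n -> R) (v d : 'rV[R]_n).

Lemma deriveEgrad f v d : differentiable f v -> 'D_d f v = dotp (grad f v) d.
Proof.
move=> df; rewrite deriveE // {1}(row_sum_delta d) linear_sum.
by apply: eq_bigr => i _; rewrite linearZ /= mxE deriveE // mulrC.
Qed.

(** Both derivatives are limits of the same difference quotient, because
    [v + (h + t) d = h d + (v + t d)]. *)
Lemma is_derive_line f v d (t : R) : differentiable f (v + t *: d) ->
  is_derive t 1 (fun s : R => f (v + s *: d)) (dotp (grad f (v + t *: d)) d).
Proof.
move=> df; rewrite -deriveEgrad //.
have quotE :
    (fun h : R =>
       h^-1 *: (f (v + (h *: (1 : R) + t) *: d) - f (v + t *: d))) =
    (fun h : R => h^-1 *: (f (h *: d + (v + t *: d)) - f (v + t *: d))).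
  by apply/funext => h; rewrite [h *: 1]mulr1 scalerDl addrCA.
apply: DeriveDef; last by rewrite /derive /= quotE.
have : derivable f (v + t *: d) d by exact: diff_derivable.
by rewrite /derivable /= quotE.
Qed.

(** The difference between [f] on the segment and its quadratic model has
    derivative [<grad f(v + s d) - grad f(v), d> - L s ||d||^2] at [s], which
    the Lipschitz bound makes nonpositive; the two sides agree at [s = 0]. *)
Lemma descent_lemma f (C : set 'rV[R]_n) (L : R) v w :
  (forall u, differentiable f u) ->
  convex_set (C : set (convex_lmodType 'rV[R]_n)) ->
  0 < L -> lipschitz_grad_on f C L -> C v -> C w ->
  forall t : R, 0 <= t <= 1 ->
  f (v + t *: (w - v)) <=
  f v + t * dotp (grad f v) (w - v) + L / 2 * t ^+ 2 * enorm (w - v) ^+ 2.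
Proof.
move=> df hC L0 lip Cv Cw t /andP[t0 t1].
set d := w - v; set e := enorm d ^+ 2; set g := dotp (grad f v) d.
pose p := fun s : R => f (v + s *: d) - (s * g + s ^+ 2 * (L / 2 * e)).
have dp (s : R) : is_derive s 1 p
    (dotp (grad f (v + s *: d)) d - (g + 2 * s * (L / 2 * e))).
  have h1 := is_derive_line (df (v + s *: d)).
  have h2 : is_derive s 1 (fun s : R => s * g + s ^+ 2 * (L / 2 * e))
      (g + 2 * s * (L / 2 * e)).
    by apply: is_derive_eq; rewrite /GRing.scale /=; ring.
  exact: is_deriveB.
have /= := @ler0_derive1_nincr R p 0 1 _ _ _ 0 t (lexx 0) t0 t1.
have -> : p 0 = f v by rewrite /p scale0r addr0; lra.
rewrite /p => H.
suff : f (v + t *: d) - (t * g + t ^+ 2 * (L / 2 * e)) <= f v by lra.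
apply: H.
- by move=> s _; exact: (@ex_derive _ _ _ _ _ _ _ (dp s)).
- move=> s; rewrite in_itv /= => /andP[s0 s1].
  rewrite derive1E (@derive_val _ _ _ _ _ _ _ (dp s)).
  suff : dotp (grad f (v + s *: d) - grad f v) d <= (L * s) * e.
    by rewrite dotpBl -/g; lra.
  apply: dotp_le_of_enorm_le; first exact: mulr_gt0.
  have Cs : C (v + s *: d) by apply: convex_segment => //; rewrite !ltW.
  have := lip _ _ Cs Cv.
  by rewrite addrAC subrr add0r enormZ ?(ltW s0) // mulrA.
- apply: derivable_within_continuous => s _.
  exact: (@ex_derive _ _ _ _ _ _ _ (dp s)).
Qed.
End Descent.

(** * One iteration, and the best of the first iterations *)

Section Run.
Context {R : realType} {n : nat}.
Implicit Types (f : 'rV[R]_n -> R) (v w : 'rV[R]_n).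

(** With [d = w - v], the projection inequality tested at [y = v] reads
    [||d||^2 + a <grad f v, d> <= phi g v w <= g ||d||^2].  The slope is thus
    nonpositive, which allows [a] to be replaced by its upper bound [amax]. *)
Lemma inexact_proj_slope f C (phi : R -> 'rV[R]_n -> 'rV[R]_n -> R)
    (amax gbar a g : R) v w :
  inexactness phi -> 0 < a <= amax -> 0 <= g <= gbar -> gbar <= 1 ->
  C v -> inexact_proj C (phi g) v (v - a *: grad f v) w ->
  dotp (grad f v) (w - v) <= - ((1 - gbar) / amax * enorm (w - v) ^+ 2).
Proof.
move=> [phile _] /andP[a0 aA] /andP[g0 gG] G1 Cv [Cw /(_ v Cv)].
have /andP[_] := phile g v w g0.
have -> : v - a *: grad f v - w = - ((w - v) + a *: grad f v).
  by rewrite opprD opprB addrAC.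
rewrite -[v - w]opprB dotpNl dotpNr opprK dotpDl dotpZl -sqr_enorm.
set e := enorm _ ^+ 2; set s := dotp _ _ => h1 h2.
have e0 : 0 <= e by rewrite exprn_ge0 // enorm_ge0.
have h3 : g * e <= gbar * e by rewrite ler_wpM2r.
have h4 : a * s <= - ((1 - gbar) * e) by lra.
have s0 : s <= 0.
  rewrite -(pmulr_rle0 _ a0) (le_trans h4) // oppr_le0 mulr_ge0 //; lra.
have A0 : 0 < amax by exact: lt_le_trans aA.
rewrite -(ler_pM2l A0) mulrN mulrAC mulrCA divff ?gt_eqF // mulr1.
apply: le_trans h4; exact: ler_wnM2r.
Qed.

(** The minimum with 1 covers the case where the full step is accepted at
    once.  Otherwise minimality of [j] says that the exponent [j - 1] fails the
    Armijo test; comparing this failure with the quadratic model and dividing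
    by the step and by [||w - v||^2], nonzero because the failed inequality is
    strict, bounds that rejected step from below. *)
Lemma armijo_step_ge f C (L sigma tau c : R) v w j :
  (forall u, differentiable f u) ->
  convex_set (C : set (convex_lmodType 'rV[R]_n)) ->
  0 < L -> lipschitz_grad_on f C L -> C v -> C w ->
  sigma < 1 -> 0 < tau < 1 ->
  dotp (grad f v) (w - v) <= - (c * enorm (w - v) ^+ 2) ->
  (forall i, armijo f sigma tau v w i -> (j <= i)%N) ->
  Num.min (2 * tau * (1 - sigma) * c / L) 1 <= tau ^+ j.
Proof.
move=> df hC L0 lip Cv Cw s1 /andP[t0 t1] hd.
case: j => [|j] hj; first by rewrite expr0 ge_min lexx orbT.
have tj0 : 0 < tau ^+ j by rewrite exprn_gt0.
have tj1 : tau ^+ j <= 1 by rewrite exprn_ile1 // ltW.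
have /negP : ~ armijo f sigma tau v w j by move=> /hj; rewrite ltnn.
rewrite /armijo -ltNge => hlt.
have := descent_lemma df hC L0 lip Cv Cw (t := tau ^+ j).
rewrite ltW // tj1 => /(_ isT) /(lt_le_trans hlt).
set t := tau ^+ j in tj0 tj1 *; set s := dotp _ _ in hd *.
set e := enorm _ ^+ 2 in hd * => H.
have e0 : 0 <= e by rewrite exprn_ge0 // enorm_ge0.
rewrite ge_min; apply/orP; left.
rewrite ler_pdivrMr // exprS -/t.
have H1 : t * ((1 - sigma) * - s) < t * (L / 2 * t * e) by lra.
rewrite ltr_pM2l // in H1.
have H2 : (1 - sigma) * (c * e) <= (1 - sigma) * - s.
  by apply: ler_wpM2l; lra.
have H3 : e * ((1 - sigma) * c) < e * (L / 2 * t) by lra.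
have e1 : 0 < e.
  rewrite lt_neqAle e0 andbT; apply/eqP => e00.
  by rewrite -e00 !mul0r ltxx in H3.
rewrite ltr_pM2l // in H3.
have : tau * ((1 - sigma) * c) <= tau * (L / 2 * t) by rewrite ler_pM2l // ltW.
lra.
Qed.

Lemma min_le_of_sum_sqr_le (u : nat -> R) (B : R) N : (1 <= N)%N ->
  (forall k, 0 <= u k) -> \sum_(0 <= k < N) u k ^+ 2 <= B ->
  \big[Num.min/u 0%N]_(0 <= k < N) u k <= Num.sqrt B * (1 / Num.sqrt N%:R).
Proof.
move=> N1 u0 hB; set m := \big[_/_]_(_ <= _ < _) _.
have N0 : 0 < N%:R :> R by rewrite ltr0n.
have m0 : 0 <= m by apply: le_bigmin.
have mle k : (k < N)%N -> m <= u k.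
  move=> kN; rewrite /m big_mkord.
  exact: (@bigmin_le _ _ _ _ (Ordinal kN) (fun i : 'I_N => u i)).
rewrite mul1r ler_pdivlMr ?sqrtr_gt0 //.
have -> : m * Num.sqrt N%:R = Num.sqrt (m ^+ 2 * N%:R).
  by rewrite sqrtrM ?sqr_ge0 // sqrtr_sqr ger0_norm.
apply: ler_wsqrtr; apply: le_trans hB.
rewrite mulr_natr -[X in _ *+ X]subn0 -sumr_const_nat.
rewrite big_nat_cond [leRHS]big_nat_cond.
apply: ler_sum => k /andP[/andP[_ kN] _].
by rewrite lerXn2r ?nnegrE ?mle.
Qed.
End Run.

(** * Rate of the best step *)

Theorem theorem25 (R : realType) (n : nat)
    (C : set 'rV[R]_n) (f : 'rV[R]_n -> R)
    (phi : R -> 'rV[R]_n -> 'rV[R]_n -> R)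
    (sigma tau amin amax gbar L : R)
    (alpha gamma : nat -> R) (j : nat -> nat)
    (x w : nat -> 'rV[R]_n) (xstar : 'rV[R]_n)
    (C_nonempty : C !=set0) (C_closed : closed C)
    (C_convex : convex_set (C : set (convex_lmodType 'rV[R]_n)))
    (f_C1 : C1 f)
    (phi_inexact : inexactness phi)
    (sigma01 : 0 < sigma < 1) (tau01 : 0 < tau < 1)
    (amin_gt0 : 0 < amin) (amin_le_amax : amin <= amax)
    (gbar_lt : gbar < 1 / 2)
    (run : GInexPM_armijo f C phi sigma tau amin amax gbar alpha gamma j x w)
    (inf_finite : (-oo < inf_on f C)%E)
    (L_gt0 : 0 < L) (grad_lip : lipschitz_grad_on f C L)
    (x_cvg : x @ \oo --> xstar) :
  let tau_min :=
    Num.min (2 * tau * (1 - sigma) * (1 - gbar) / (amax * L)) 1 in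
  forall N : nat, (1 <= N)%N ->
    (* the seed is the term k = 0, so this is the minimum over 0 <= k < N *)
    \big[Num.min/enorm (w 0%N - x 0%N)]_(0 <= k < N) enorm (w k - x k) <=
    Num.sqrt (amax * (f (x 0%N) - fine (inf_on f C)) /
              (sigma * tau_min * (1 - gbar))) * (1 / Num.sqrt N%:R).
Proof.
move=> tau_min N N1.
have [df _] := f_C1; have /andP[s0 s1] := sigma01; have /andP[t0 t1] := tau01.
case: run => x0C alphaP gammaP projP _ search search_min next.
have amax0 : 0 < amax by exact: lt_le_trans amin_le_amax.
have g1 : 0 < 1 - gbar by lra.
pose c := (1 - gbar) / amax.
have c0 : 0 < c by rewrite divr_gt0.
have wC k : C (w k) by case: (projP k).
have xC k : C (x k).
  elim: k => [//|k IH]; rewrite next; apply: convex_segment => //.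
  by rewrite exprn_ge0 ?exprn_ile1 // ltW.
have hdesc k :
    dotp (grad f (x k)) (w k - x k) <= - (c * enorm (w k - x k) ^+ 2).
  apply: inexact_proj_slope (projP k) => //; last lra.
  by have /andP[h ->] := alphaP k; rewrite andbT (lt_le_trans amin_gt0).
have tmin k : tau_min <= tau ^+ j k.
  have := armijo_step_ge df C_convex L_gt0 grad_lip (xC k) (wC k)
    s1 tau01 (hdesc k) (@search_min k).
  suff -> : 2 * tau * (1 - sigma) * c / L =
      2 * tau * (1 - sigma) * (1 - gbar) / (amax * L) by [].
  by rewrite /c; field; rewrite !gt_eqF.
have tmin0 : 0 < tau_min.
  rewrite lt_min ltr01 andbT divr_gt0 ?mulr_gt0 //; lra.
clearbody tau_min.
have decr k : sigma * tau_min * c * enorm (w k - x k) ^+ 2 <=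
    f (x k) - f (x k.+1).
  have := search k; rewrite /armijo -next => hs.
  have e0 : 0 <= enorm (w k - x k) ^+ 2 by rewrite exprn_ge0 // enorm_ge0.
  have st0 := mulr_gt0 s0 (lt_le_trans tmin0 (tmin k)).
  have h1 := ler_wpM2l (ltW st0) (hdesc k).
  have h2 : sigma * tau_min * (c * enorm (w k - x k) ^+ 2) <=
            sigma * tau ^+ j k * (c * enorm (w k - x k) ^+ 2).
    apply: ler_wpM2r; last by rewrite ler_pM2l.
    by rewrite mulr_ge0 // ltW.
  lra.
have fstar : fine (inf_on f C) <= f (x N).
  have h : (inf_on f C <= (f (x N))%:E)%E.
    by apply: ereal_inf_lbound; exists (x N).
  move: h inf_finite; case: (inf_on f C) => //= r; by rewrite lee_fin.
apply: min_le_of_sum_sqr_le => // [k|]; first exact: enorm_ge0.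
have -> : amax * (f (x 0%N) - fine (inf_on f C)) /
     (sigma * tau_min * (1 - gbar)) =
     (f (x 0%N) - fine (inf_on f C)) / (sigma * tau_min * c).
  by rewrite /c; field; rewrite !gt_eqF.
have K0 : 0 < sigma * tau_min * c by apply: mulr_gt0 => //; exact: mulr_gt0.
rewrite (ler_pdivlMr _ _ K0) mulr_suml.
apply: (@le_trans _ _ (\sum_(0 <= k < N) (f (x k) - f (x k.+1)))).
  by apply: ler_sum => k _; rewrite mulrC.
rewrite (telescope_sumr_eq (fun k => - f (x k))) //; first lra.
by move=> k _; rewrite opprK addrC.
Qed.
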